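(* Let $k$ and $m$ be positive integers such that $\gcd(k,m)=1$ and $m<k<\sigma(m)$. If a positive integer $n$ has abundancy index $\lambda(n)=\frac{k}{k-m}$, then $n$ is not feebly amicable with any other positive integer; that is, there is no positive integer $l\neq n$ with $\frac{1}{\lambda(n)}+\frac{1}{\lambda(l)}=1$.
   Context: For a positive integer $n$, $\sigma(n)$ denotes the sum of all positive divisors of $n$ (including $n$), and the abundancy index is $\lambda(n)=\frac{\sigma(n)}{n}$. Two positive integers $m,n$ are called feebly amicable if $\frac{n}{\sigma(n)}+\frac{m}{\sigma(m)}=1$, equivalently $\frac{1}{\lambda(n)}+\frac{1}{\lambda(m)}=1$. *)

(* Defs.v *)
From mathcomp Require Import all_boot all_order all_algebra.

Set Implicit Arguments.
Unset Strict Implicit.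
Unset Printing Implicit Defensive.

Import GRing.Theory.

Definition sigma (n : nat) : nat := \sum_(d <- divisors n) d.

Local Open Scope ring_scope.

Definition abundancy (n : nat) : rat := (sigma n)%:R / n%:R.

(* Meant for positive m and n; positivity is a separate hypothesis wherever
   this is used. *)
Definition feebly_amicable (m n : nat) : Prop :=
  n%:R / (sigma n)%:R + m%:R / (sigma m)%:R = 1 :> rat.

Lemma feebly_amicableE (m n : nat) :
  feebly_amicable m n <-> 1 / abundancy n + 1 / abundancy m = 1.
Proof. by rewrite /feebly_amicable /abundancy !div1r !invf_div. Qed.

(* Main.v *)
Require Import Defs.
From mathcomp Require Import all_boot all_order all_algebra.

(** Any [l] feebly amicable with [n] has abundancy index [k / m]. As this
    fraction is in lowest terms, [m] divides [l]; and since the abundancy index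
    grows along divisibility, [k / m >= sigma m / m], contradicting
    [k < sigma m]. *)

Import GRing.Theory Num.Theory.

Local Open Scope ring_scope.

Lemma leq_mul_sigma (q : nat) {m : nat} :
  (0 < m)%N -> (q * sigma m <= sigma (q * m))%N.
Proof.
move=> m_gt0; case: (posnP q) => [-> // | q_gt0].
rewrite /sigma big_distrr /= -(big_map (muln q) xpredT id).
apply: (@uniq_sub_le_big _ addn leq leqnn (fun a b => leq_addr b a)).
- rewrite map_inj_uniq ?divisors_uniq // => d e /eqP.
  by rewrite eqn_pmul2l // => /eqP.
- exact: divisors_uniq.
- move=> _ /mapP[d d_dvd_m ->]; move: d_dvd_m.
  by rewrite -!dvdn_divisors ?muln_gt0 ?q_gt0 // dvdn_pmul2l.
Qed.

Lemma ler_abundancy_dvd {m n : nat} :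
  (0 < n)%N -> (m %| n)%N -> abundancy m <= abundancy n.
Proof.
move=> n_gt0 /dvdnP[q n_eq].
have /andP[q_gt0 m_gt0] : (0 < q)%N && (0 < m)%N by rewrite -muln_gt0 -n_eq.
have -> : abundancy m = (q * sigma m)%:R / n%:R.
  by rewrite n_eq !natrM -mulf_div divff ?mul1r // pnatr_eq0 -lt0n.
by rewrite ler_pM2r ?invr_gt0 ?ltr0n // ler_nat n_eq leq_mul_sigma.
Qed.

Lemma dvdn_abundancy_denom {k m n : nat} :
    (0 < m)%N -> (0 < n)%N -> coprime k m ->
  abundancy n = k%:R / m%:R -> (m %| n)%N.
Proof.
move=> m_gt0 n_gt0 co_km /eqP.
rewrite /abundancy eqr_div ?pnatr_eq0 -?lt0n // -!natrM eqr_nat.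
move=> /eqP cross_eq.
by rewrite -(@Gauss_dvdr m k) 1?coprime_sym // -cross_eq dvdn_mull.
Qed.

Lemma abundancy_neq_lt_sigma {k m : nat} (n : nat) :
    (0 < m)%N -> (0 < n)%N -> coprime k m -> (k < sigma m)%N ->
  abundancy n <> k%:R / m%:R.
Proof.
move=> m_gt0 n_gt0 co_km lt_k_sigma abundancy_n.
have m_dvd_n := dvdn_abundancy_denom m_gt0 n_gt0 co_km abundancy_n.
have := ler_abundancy_dvd n_gt0 m_dvd_n.
by rewrite abundancy_n ler_pM2r ?invr_gt0 ?ltr0n // ler_nat leqNgt lt_k_sigma.
Qed.

Lemma feebly_amicable_abundancy {n l : nat} {x y : rat} :
    x != 0 -> abundancy n = x / (x - y) -> feebly_amicable n l ->
  abundancy l = x / y.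
Proof.
move=> x_neq0 abundancy_n /feebly_amicableE.
rewrite !div1r abundancy_n (invf_div x) => /(canRL (addrK _)) inv_abundancy_l.
apply: invr_inj; rewrite inv_abundancy_l invf_div.
by rewrite mulrBl divff // subKr.
Qed.

Theorem theorem8p1 (k m n : nat)
  (k_gt0 : (0 < k)%N) (m_gt0 : (0 < m)%N) (n_gt0 : (0 < n)%N)
  (co_km : gcdn k m = 1%N) (lt_mk : (m < k)%N) (lt_k_sigma : (k < sigma m)%N)
  (lambda_n : abundancy n = k%:R / (k%:R - m%:R)) :
  ~ exists l : nat, [/\ (0 < l)%N, l <> n & feebly_amicable n l].
Proof.
case=> l [l_gt0 _ amicable_nl].
have k_neq0 : k%:R != 0 :> rat by rewrite pnatr_eq0 -lt0n.
have coprime_km : coprime k m by apply/eqP.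
apply: (abundancy_neq_lt_sigma l m_gt0 l_gt0 coprime_km lt_k_sigma).
exact: feebly_amicable_abundancy k_neq0 lambda_n amicable_nl.
Qed.
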